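(* Let $\mathcal F$ be a filter on $\omega$ such that for any partition $\langle A_n : n<\omega\rangle$ of $\omega$ into sets not in $\mathcal F$ there is a set $B\subseteq\omega$ such that both $\bigcup_{n\in B}A_n$ and $\bigcup_{n\notin B}A_n$ are $\mathcal F$-positive. Then no injective sequence $\bar x=\langle x_n : n<\omega\rangle$ of points of $\beta\omega$ has an $\mathcal F$-limit in $\beta\omega$.
   Context: A set $A\subseteq\omega$ is $\mathcal F$-positive if $\omega\setminus A\notin\mathcal F$. A sequence $\langle x_n:n<\omega\rangle$ is injective if $x_n\neq x_k$ whenever $n\neq k$. For a topological space $X$, a sequence $\bar x=\langle x_n:n<\omega\rangle$ in $X$ and a point $x\in X$, $x$ is an $\mathcal F$-limit of $\bar x$ if for every neighbourhood $U$ of $x$ the set $\{n<\omega : x_n\in U\}$ belongs to $\mathcal F$. The space $\beta\omega$ is the Čech–Stone compactification of the discrete space $\omega$, identified with the set of all ultrafilters on $\omega$, with base of (clopen) sets $\hat A=\{p\in\beta\omega : A\in p\}$ for $A\subseteq\omega$.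
   Formalization: The filter F is assumed proper and to contain all cofinite subsets of ω; without this the claim fails, e.g. for F = {A : 0 ∈ A and A ∈ p} with p a free ultrafilter, x_0 = p and x_k the principal ultrafilter at k for k > 0. *)

(* Defs.v *)
From HB Require Import structures.
From mathcomp Require Import all_boot.
From mathcomp Require Import boolp classical_sets functions cardinality filter.
From mathcomp Require Import topology.

Set Implicit Arguments.
Unset Strict Implicit.
Unset Printing Implicit Defensive.

Local Open Scope classical_set_scope.

Definition positive (F : set_system nat) (A : set nat) : Prop := ~ F (~` A).

(* A filter on omega is understood to be proper and to extend the Frechet
   filter; equivalently, it is proper and its members have empty intersection. *)
Definition free_filter (F : set_system nat) : Prop :=
  forall A : set nat, cofinite_set A -> F A.

Record beta_omega : Type := BetaOmega {
  ultra_sets : set_system nat;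
  ultra_setsP : UltraFilter ultra_sets
}.

Definition hat (A : set nat) : set beta_omega := [set p | ultra_sets p A].

Lemma hatT : hat setT = setT.
Proof.
by apply/seteqP; split => // p _; have := ultra_setsP p => ?; exact: filterT.
Qed.

Lemma hatI (A B : set nat) : hat (A `&` B) = hat A `&` hat B.
Proof.
apply/seteqP; split=> p /=; have := ultra_setsP p => ?.
  by move=> pAB; split; apply: filterS pAB => n [].
by move=> [pA pB]; exact: filterI.
Qed.

Lemma hat_cover : \bigcup_(A in [set: set nat]) hat A = setT.
Proof. by apply/seteqP; split=> // p _; exists setT => //; rewrite hatT. Qed.

Lemma hat_join (A B : set nat) (p : beta_omega) :
  [set: set nat] A -> [set: set nat] B -> hat A p -> hat B p ->
  exists C, [/\ [set: set nat] C, hat C p & hat C `<=` hat A `&` hat B].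
Proof. by move=> _ _ pA pB; exists (A `&` B); rewrite hatI; split. Qed.

HB.instance Definition _ := gen_eqMixin beta_omega.
HB.instance Definition _ := gen_choiceMixin beta_omega.
(* The topology whose base is the family of all sets [hat A]. *)
HB.instance Definition _ :=
  isBaseTopological.Build beta_omega hat_cover hat_join.

(* Main.v *)
(* Let p be an F-limit of x.  As x is injective, x_n <> p for all n but at most
   one, and then some D_n in x_n is not in p.  Send n to the least k with D_k in
   x_n, and for B a set of indices let U_B be the set of points m for which the
   least k with m in D_k lies in B.  If U_B is not in p, then the F-limit property
   makes the preimage of ~B a member of F.  In particular fibres are F-null, so the
   splitting hypothesis gives B such that neither the preimage of B nor that of ~B
   is in F.  Hence both U_B and U_{~B} belong to p, although they are disjoint. *)
Require Import Defs.
From mathcomp Require Import all_boot finmap.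
From mathcomp Require Import boolp classical_sets functions cardinality filter.
From mathcomp Require Import topology.

Set Implicit Arguments.
Unset Strict Implicit.

Local Open Scope classical_set_scope.

Definition partition_splitting (F : set_system nat) : Prop :=
  forall A : nat -> set nat,
    partition [set: nat] A [set: nat] ->
    (forall n, ~ F (A n)) ->
    exists B : set nat,
      positive F (\bigcup_(n in B) A n) /\
      positive F (\bigcup_(n in ~` B) A n).

(** With a finite range, finitely many complements of fibres would intersect in a member of [F], but
    that intersection is empty. *)
Lemma infinite_range_of_null_fibers (F : set_system nat)
    (F_filter : ProperFilter F) (f : nat -> nat) :
  (forall k, F (f @^-1` (~` [set k]))) -> infinite_set (range f).
Proof.
move=> f_null /finite_fsetP[X rangeX].
have /filter_ex[n] : F (\bigcap_(k in [set` X]) f @^-1` (~` [set k])).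
  exact: filter_bigI.
by move=> /(_ (f n)); rewrite -rangeX; apply; [exists n|].
Qed.

(* A partition in the sense of [partition] has nonempty parts, so the fibres of
   [f] are first reindexed along a bijection from [nat] to the range of [f]. *)
Lemma fibers_split (F : set_system nat) (F_filter : ProperFilter F)
    (F_split : partition_splitting F) (f : nat -> nat) :
  (forall k, F (f @^-1` (~` [set k]))) ->
  exists B, positive F (f @^-1` B) /\ positive F (f @^-1` (~` B)).
Proof.
move=> f_null.
have card_range : (range f #= [set: nat])%card.
  by apply: eq_card_nat => //; exact: infinite_range_of_null_fibers f_null.
have /card_esym/card_set_bijP[g [gS gI gO]] := card_range.
have [] := F_split (fun n => f @^-1` [set g n]).
- split.
  + apply/seteqP; split=> // n _.
    by have [k _ gk] := gO (f n) (imageT f n); exists k.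
  + move=> i j _ _ [n [/= fi fj]].
    by apply: gI; rewrite ?inE// -fi -fj.
  + by move=> k _; have [n _ fn] := gS k I; exists n.
- move=> k Fk; have [n []] := filter_ex (filterI Fk (f_null (g k))).
  by move=> /= ->; apply.
move=> B [posB posCB]; exists (g @` B); split.
- congr (positive F _): posB; apply/seteqP; split=> n.
    by move=> [k Bk /= fn]; exists k.
  by move=> [k Bk fn]; exists k.
- congr (positive F _): posCB; apply/seteqP; split=> n.
    move=> [k CBk /= fn] [j Bj gj]; apply: CBk.
    by rewrite -(gI j k) ?inE// gj fn.
  move=> nB; have [k _ gk] := gO (f n) (imageT f n).
  by exists k => // Bk; apply: nB; exists k.
Qed.

Lemma beta_omega_inj (p q : beta_omega) : ultra_sets p = ultra_sets q -> p = q.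
Proof.
by case: p q => [P uP] [Q uQ] /= PQ; subst Q; rewrite (Prop_irrelevance uP uQ).
Qed.

(** Otherwise [p] is contained in [q], and maximality of ultrafilters makes them equal. *)
Lemma beta_omega_separated (p q : beta_omega) :
  p <> q -> exists2 D, ultra_sets p D & ~ ultra_sets q D.
Proof.
move=> pq; apply: contrapT => nD; apply: pq; apply/esym/beta_omega_inj.
have uP := ultra_setsP p; have uQ := ultra_setsP q.
apply: max_filter => D pD; apply: contrapT => qD.
by apply: nD; exists D.
Qed.

Lemma open_hat (A : set nat) : open (hat A).
Proof. by exists [set A] => //; rewrite bigcup_set1. Qed.

Lemma beta_omega_lim (F : set_system nat) (F_filter : Filter F)
    (x : nat -> beta_omega) (p : beta_omega) (A : set nat) :
  x n @[n --> F] --> p -> ultra_sets p A -> F [set n | ultra_sets (x n) A].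
Proof.
move=> xp pA; apply: (xp (hat A)); apply: open_nbhs_nbhs.
by split; first exact: open_hat.
Qed.

(** This is the set [U_B], the preimage of [B] under a partial map: points outside every [D k]
    belong to none of these sets. *)
Definition first_hit (D : nat -> set nat) (B : set nat) : set nat :=
  [set m | exists2 k, B k & D k m /\ forall j, (j < k)%N -> ~ D j m].

Lemma first_hit_disjoint D B : first_hit D B `&` first_hit D (~` B) = set0.
Proof.
apply/seteqP; split=> // m [[k Bk [Dk kmin]] [j Bj [Dj jmin]]].
case: (ltngtP j k) => [/kmin//|/jmin//|jk].
by apply: Bj; rewrite jk.
Qed.

Lemma first_hit1 D k : first_hit D [set k] `<=` D k.
Proof. by move=> m [_ -> []]. Qed.

(** Take the least [k] with [D k] in [p]: the complements of the finitely many earlier sets are in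
    [p], hence so is [D k] minus all of them. *)
Lemma first_hit_ultra (D : nat -> set nat) (p : beta_omega) :
  (exists n, ultra_sets p (D n)) ->
  exists k, forall B : set nat, B k -> ultra_sets p (first_hit D B).
Proof.
move=> pD; have uP := ultra_setsP p.
have : exists n, `[< ultra_sets p (D n) >] by case: pD => n /asboolP; exists n.
move=> /ex_minnP[k /asboolP pDk kmin]; exists k => B Bk.
have pCD : ultra_sets p [set m | forall j : 'I_k, ~ D j m].
  apply: filter_forall => j.
  have [/asboolP/kmin|//] := in_ultra_setVsetC (D j) uP.
  by rewrite leqNgt ltn_ord.
apply: filterS (filterI pDk pCD) => m [Dkm CDm]; exists k => //; split=> // j jk.
exact: (CDm (Ordinal jk)).
Qed.

Theorem theorem2p1 (F : set_system nat) (F_filter : ProperFilter F)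
  (F_free : free_filter F)
  (F_split : forall A : nat -> set nat,
     partition [set: nat] A [set: nat] ->
     (forall n, ~ F (A n)) ->
     exists B : set nat,
       positive F (\bigcup_(n in B) A n) /\
       positive F (\bigcup_(n in ~` B) A n)) :
  forall x : nat -> beta_omega, injective x ->
    ~ exists p : beta_omega, x n @[n --> F] --> p.
Proof.
move=> x x_inj [p xp]; have uP := ultra_setsP p.
have F_neq : F [set n | x n <> p].
  apply: F_free; have [[n xnp]|nx] := pselect (exists n, x n = p).
    apply: (@sub_finite_set _ _ [set n]) => // m /contrapT xmp.
    by apply: x_inj; rewrite xmp xnp.
  apply: (@sub_finite_set _ _ set0) => // m /contrapT xmp.
  by apply: nx; exists m.
have /choice[D DP] : forall n, exists D,
    (x n <> p -> ultra_sets (x n) D) /\ ~ ultra_sets p D.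
  move=> n; have [xnp|xnp] := pselect (x n = p).
    (* The default [set0] keeps [D n] outside [p] for every [n], as [f_null] needs even at an index
       with [x n = p]. *)
    by exists set0; split=> //; exact: filter_not_empty.
  by have [D xD pD] := beta_omega_separated xnp; exists D.
have /choice[f fP] : forall n, exists k, x n <> p ->
    forall B : set nat, B k -> ultra_sets (x n) (first_hit D B).
  (* The value 0 at an index with [x n = p] is arbitrary, since [F_neq] discards that index. *)
  move=> n; have [xnp|xnp] := pselect (x n = p); first by exists 0.
  have [|k kP] := @first_hit_ultra D (x n); last by exists k.
  by exists n; apply: (DP n).1.
have null_preimage B : ~ ultra_sets p (first_hit D B) -> F (f @^-1` (~` B)).
  move=> pB; have [//|pCB] := in_ultra_setVsetC (first_hit D B) uP.
  (* If [f n] were in [B], the ultrafilter [x n] would contain both [first_hit D B] and its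
     complement. *)
  apply: filterS (filterI F_neq (beta_omega_lim F_filter xp pCB)).
  move=> n [xnp xnB] /= fnB; have uX := ultra_setsP (x n).
  by have [m []] := filter_ex (filterI (fP n xnp B fnB) xnB).
have f_null k : F (f @^-1` (~` [set k])).
  by apply: null_preimage => /(filterS (@first_hit1 D k)); apply: (DP k).2.
have [B [posB posCB]] := fibers_split F_filter F_split f_null.
have pB : ultra_sets p (first_hit D B).
  by apply: contrapT => /null_preimage; rewrite preimage_setC.
have pCB : ultra_sets p (first_hit D (~` B)).
  by apply: contrapT => /null_preimage; rewrite preimage_setC.
apply: (@filter_not_empty _ (ultra_sets p)).
by rewrite -(first_hit_disjoint D B); exact: filterI.
Qed.
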